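(* Let $V$ be a finite nontrivial irreducible conformal module over the extended Schrödinger–Virasoro conformal algebra $\widetilde{\mathrm{SV}}$. Then $V\cong V(\alpha,\beta,\Delta)$ for some $\alpha,\beta,\Delta\in\mathbb{C}$ with $(\Delta,\beta)\neq(0,0)$.
   Context: A Lie conformal algebra is a $\mathbb{C}[\partial]$-module $R$ with a $\lambda$-bracket satisfying conformal sesquilinearity, skew-symmetry and Jacobi identity; a conformal module over $R$ is a $\mathbb{C}[\partial]$-module $V$ with $a\mapsto a_\lambda\in\mathrm{End}_{\mathbb{C}}(V)\otimes\mathbb{C}[\lambda]$ satisfying $[a_\lambda,b_\mu]=[a_\lambda b]_{\lambda+\mu}$ and $(\partial a)_\lambda=[\partial,a_\lambda]=-\lambda a_\lambda$. It is finite if finitely generated over $\mathbb{C}[\partial]$, irreducible if it has no nontrivial proper submodules, and trivial if all $a_\lambda$ act by zero. $\widetilde{\mathrm{SV}}$ is the free $\mathbb{C}[\partial]$-module with basis $L,M,Y,N$ whose nonzero $\lambda$-brackets (up to skew-symmetry) are $[L_\lambda L]=(\partial+2\lambda)L$, $[L_\lambda Y]=(\partial+\tfrac32\lambda)Y$, $[L_\lambda M]=(\partial+\lambda)M$, $[Y_\lambda Y]=(\partial+2\lambda)M$, $[L_\lambda N]=(\partial+\lambda)N$, $[N_\lambda M]=2M$, $[N_\lambda Y]=Y$. For $\alpha,\beta,\Delta\in\mathbb{C}$, $V(\alpha,\beta,\Delta)=\mathbb{C}[\partial]v_\Delta$ is the free rank-one module with $L_\lambda v_\Delta=(\partial+\alpha+\Delta\lambda)v_\Delta$,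 $N_\lambda v_\Delta=\beta v_\Delta$, $M_\lambda v_\Delta=Y_\lambda v_\Delta=0$. *)

(* Defs.v *)
From HB Require Import structures.
From mathcomp Require Import all_boot all_order all_algebra.
From mathcomp Require Import complex reals.
Set Implicit Arguments. Unset Strict Implicit. Unset Printing Implicit Defensive.
Import Order.TTheory GRing.Theory Num.Theory.
Local Open Scope ring_scope.

(* The C[∂]-basis L, M, Y, N of the extended Schrödinger–Virasoro conformal
   algebra SV~. *)
Inductive svgen := gL | gM | gY | gN.

Section SV.
Variable R : realType.
Local Notation C := (R[i])%C.

(* Coefficient of the basis element c in the listed brackets [a_lam b],
   written as a polynomial function of lam and del (= ∂). *)
Definition sv_br0 (a b c : svgen) (lam del : C) : C :=
  match a, b, c with
  | gL, gL, gL => del + 2%:R * lam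
  | gL, gY, gY => del + (3%:R / 2%:R) * lam
  | gL, gM, gM => del + lam
  | gY, gY, gM => del + 2%:R * lam
  | gL, gN, gN => del + lam
  | gN, gM, gM => 2%:R
  | gN, gY, gY => 1
  | _, _, _ => 0
  end.

Definition sv_listed (a b : svgen) : bool :=
  match a, b with
  | gL, gL | gL, gY | gL, gM | gY, gY | gL, gN | gN, gM | gN, gY => true
  | _, _ => false
  end.

(* Full lambda-bracket, the remaining ones obtained by skew-symmetry
   [b_lam a] = - [a_{-lam-∂} b]; all others vanish. *)
Definition sv_br (a b c : svgen) (lam del : C) : C :=
  if sv_listed a b then sv_br0 a b c lam del
  else - sv_br0 b a c (- lam - del) del.

Section Module.
Variable V : lmodType C.

(* An element of V[lam] is a coefficient list [:: w_0; w_1; ...] standing for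
   w_0 + w_1 lam + w_2 lam^2 + ...; evaluation at lam (Horner). *)
Definition evl (s : seq V) (lam : C) : V := foldr (fun w acc => w + lam *: acc) 0 s.

Definition pev (p : {poly C}) (d : V -> V) (v : V) : V :=
  \sum_(i < size p) p`_i *: iter i d v.

(* A conformal module structure over SV~ on V: d is the action of ∂, and
   act a v is the coefficient list of a_lam v in V[lam], for a basis element a.
   The action of a general element of SV~ = ⊕ C[∂] a is then determined by
   (p(∂) a)_lam = p(-lam) a_lam. *)
Definition is_conf_module (d : V -> V) (act : svgen -> V -> seq V) : Prop :=
  [/\ (forall (c : C) (x y : V), d (c *: x + y) = c *: d x + d y),
      (forall a k (c : C) (x y : V),
          nth 0 (act a (c *: x + y)) k = c *: nth 0 (act a x) k + nth 0 (act a y) k),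
      (forall a (lam : C) (v : V),
          d (evl (act a v) lam) - evl (act a (d v)) lam = - lam *: evl (act a v) lam)
    &
      (forall a b (lam mu : C) (v : V),
          evl (act a (evl (act b v) mu)) lam - evl (act b (evl (act a v) lam)) mu
          = \sum_(c <- [:: gL; gM; gY; gN])
               sv_br a b c lam (- (lam + mu)) *: evl (act c v) (lam + mu))].

Definition conf_finite (d : V -> V) : Prop :=
  exists gs : seq V, forall v : V, exists ps : seq {poly C},
    v = \sum_(pg <- zip ps gs) pev pg.1 d pg.2.

Definition conf_submodule (d : V -> V) (act : svgen -> V -> seq V) (U : V -> Prop) : Prop :=
  [/\ U 0,
      (forall (c : C) x y, U x -> U y -> U (c *: x + y)),
      (forall x, U x -> U (d x))
    & (forall a x k, U x -> U (nth 0 (act a x) k))].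

Definition conf_irreducible (d : V -> V) (act : svgen -> V -> seq V) : Prop :=
  forall U, conf_submodule d act U -> (forall x, U x -> x = 0) \/ (forall x, U x).

Definition conf_trivial (act : svgen -> V -> seq V) : Prop :=
  forall a v k, nth 0 (act a v) k = 0.

End Module.

Definition conf_iso (V W : lmodType C) (dV : V -> V) (actV : svgen -> V -> seq V)
    (dW : W -> W) (actW : svgen -> W -> seq W) : Prop :=
  exists phi : V -> W,
    [/\ (forall (c : C) x y, phi (c *: x + y) = c *: phi x + phi y),
        bijective phi,
        (forall x, phi (dV x) = dW (phi x))
      & (forall a x k, phi (nth 0 (actV a x) k) = nth 0 (actW a (phi x)) k)].

(* The rank-one module V(alpha,beta,Delta) = C[∂] v_Delta, realised on {poly C}
   (p stands for p(∂) v_Delta).  By sesquilinearity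
     L_lam (p(∂) v) = p(∂+lam) (∂ + alpha + Delta lam) v,
     N_lam (p(∂) v) = p(∂+lam) beta v,  M_lam = Y_lam = 0,
   and p(∂+lam) = \sum_k lam^k p^`N(k)(∂) (Taylor expansion). *)
Definition Vrk1_d (p : {poly C}) : {poly C} := 'X * p.

Definition Vrk1_act (alpha beta Delta : C) (a : svgen) (p : {poly C}) : seq {poly C} :=
  match a with
  | gL => [seq p^`N(k) * ('X + alpha%:P)
               + (if k is k'.+1 then Delta *: p^`N(k') else 0)
          | k <- iota 0 (size p).+1]
  | gN => [seq beta *: p^`N(k) | k <- iota 0 (size p)]
  | gM => [::]
  | gY => [::]
  end.

End SV.

(* Main.v *)
(* Write a_k for the coefficients of a_lambda and filter V by
     F_n = {v | L_k v = 0 for k >= n, and M_k v = Y_k v = N_k v = 0 for k + 1 >= n}.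
   If n is least with F_(n+1) <> 0 (F_0 = 0, being a submodule), then
   [d, a_k] = - a_(k-1) shows that C[d] (x) F_(n+1) -> V is injective, so F_(n+1) is
   finite-dimensional, and it is stable under all modes of M,
   N, Y (once M = 0) and the positive modes of L.  On it [N_0, M_k] = 2 M_k makes the
   M_k simultaneously nilpotent; since M is an ideal, the vectors killed by M form a
   nonzero submodule, hence M = 0, and likewise Y = 0.  Now N_0 and L_0 - d are module
   endomorphisms with an eigenvector, hence scalars, and the L_1-weights give a vector v
   of F_(n+1) killed by N_k (k >= 1) and L_k (k >= 2), with L_1 v = Delta v.
   It spans V over C[d]. *)

Require Import Defs.
From HB Require Import structures.
From mathcomp Require Import all_boot all_order all_algebra.
From mathcomp Require Import complex reals boolp.
From mathcomp Require Import zify ring.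
Set Implicit Arguments. Unset Strict Implicit. Unset Printing Implicit Defensive.
Import Order.TTheory GRing.Theory Num.Theory.
Local Open Scope ring_scope.

(** Vandermonde argument: the moment relations extend linearly to \sum_k q(x_k) w_k = 0 for every
    polynomial q, and the product of the X - x_k over k != i isolates w_i. *)
Lemma separate (F : fieldType) (V : lmodType F) n (x : nat -> F) (w : nat -> V) :
  {in gtn n &, injective x} ->
  (forall j, \sum_(i < n) x i ^+ j *: w i = 0) ->
  forall i, (i < n)%N -> w i = 0.
Proof.
move=> injx w0 i lt_in.
have q0 (q : {poly F}) : \sum_(k < n) q.[x k] *: w k = 0.
  under eq_bigr => k _ do rewrite horner_coef scaler_suml.
  rewrite exchange_big big1 //= => j _.
  under eq_bigr => k _ do rewrite -scalerA.
  by rewrite -scaler_sumr w0 scaler0.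
pose q : {poly F} := \prod_(k < n | k != i :> nat) ('X - (x k)%:P).
have := q0 q.
rewrite (bigD1 (Ordinal lt_in)) //= big1 => [|k]; last first.
  rewrite -val_eqE /= => ne_ki.
  by rewrite /q horner_prod (bigD1 k) //= hornerXsubC subrr mul0r scale0r.
move/eqP; rewrite addr0 scaler_eq0 => /orP[|/eqP //].
rewrite /q horner_prod => /prodf_eq0[k ne_ki].
rewrite hornerXsubC subr_eq0 => /eqP /injx; rewrite !inE => /(_ lt_in (ltn_ord k)) eq_ik.
by rewrite eq_ik eqxx in ne_ki.
Qed.

(** * Polynomials in a linear operator *)

Section Pev.
Variable R : realType.
Local Notation C := (R[i])%C.
Variable V : lmodType C.
Implicit Types (d T : {linear V -> V}) (p q : {poly C}) (v : V).

Lemma pev_widen p (d : V -> V) v n : (size p <= n)%N ->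
  pev p d v = \sum_(i < n) p`_i *: iter i d v.
Proof.
move=> le_pn; rewrite /pev (big_ord_widen n (fun i => p`_i *: iter i d v)) //.
rewrite big_mkcond; apply: eq_bigr => i _.
by case: ltnP => // /(nth_default 0) ->; rewrite scale0r.
Qed.

Lemma pev0 (d : V -> V) v : pev 0 d v = 0.
Proof. by rewrite /pev size_poly0 big_ord0. Qed.

Lemma pevC c (d : V -> V) v : pev c%:P d v = c *: v.
Proof. by rewrite (@pev_widen _ _ _ 1) ?size_polyC_leq1 // big_ord1 coefC. Qed.

Lemma pev_lin c p q (d : V -> V) v : pev (c *: p + q) d v = c *: pev p d v + pev q d v.
Proof.
pose n := maxn (size p) (size q).
rewrite !(@pev_widen _ _ _ n) ?leq_maxl ?leq_maxr //; last first.
  rewrite (leq_trans (size_polyD _ _)) // geq_max leq_maxr andbT.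
  by rewrite (leq_trans (size_scale_leq _ _)) ?leq_maxl.
rewrite scaler_sumr -big_split; apply: eq_bigr => i _ /=.
by rewrite coefD coefZ scalerDl scalerA.
Qed.

Lemma pevD p q (d : V -> V) v : pev (p + q) d v = pev p d v + pev q d v.
Proof. by rewrite -[p in LHS]scale1r pev_lin scale1r. Qed.

Lemma pevZ c p (d : V -> V) v : pev (c *: p) d v = c *: pev p d v.
Proof. by rewrite -[_ *: p]addr0 pev_lin pev0 addr0. Qed.

Lemma pev_sum (I : Type) (r : seq I) (P : pred I) (F : I -> {poly C}) (d : V -> V) v :
  pev (\sum_(i <- r | P i) F i) d v = \sum_(i <- r | P i) pev (F i) d v.
Proof.
by apply: (big_morph (fun p => pev p d v)) => [p q|]; rewrite ?pevD ?pev0.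
Qed.

Lemma iter_linear T n : linear (iter n T).
Proof. by elim: n => //= n IHn c x y; rewrite /= IHn linearP. Qed.

Lemma iter_linZ T n c x : iter n T (c *: x) = c *: iter n T x.
Proof. by elim: n => //= n ->; rewrite linearZ. Qed.

Lemma iter_lin0 T n : iter n T 0 = 0.
Proof. by elim: n => //= n ->; rewrite linear0. Qed.

Lemma iter_lin_sum (I : Type) (r : seq I) (P : pred I) (F : I -> V) T n :
  iter n T (\sum_(i <- r | P i) F i) = \sum_(i <- r | P i) iter n T (F i).
Proof. by elim: n => //= n ->; rewrite linear_sum. Qed.

Lemma pev_linear p T : linear (pev p T).
Proof.
move=> c x y; rewrite /pev scaler_sumr -big_split; apply: eq_bigr => i _ /=.
by rewrite iter_linear scalerDr !scalerA mulrC.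
Qed.

HB.instance Definition _ p T := GRing.isLinear.Build C V V *:%R (pev p T) (pev_linear p T).

Lemma pevMX p T v : pev (p * 'X) T v = T (pev p T v).
Proof.
rewrite (@pev_widen _ _ _ (size p).+1); last first.
  by rewrite (leq_trans (size_polyMleq _ _)) // size_polyX addn2.
rewrite big_ord_recl coefMX scale0r add0r linear_sum.
by apply: eq_bigr => i _; rewrite coefMX linearZ.
Qed.

Lemma pevM p q T v : pev (p * q) T v = pev p T (pev q T v).
Proof.
elim/poly_ind: p => [|p c IHp]; first by rewrite mul0r !pev0.
rewrite mulrDl mulrAC !pevD !pevMX IHp pevC.
by rewrite mul_polyC pevZ.
Qed.

End Pev.

(** * Coefficients of the lambda-action *)

Section Coefficients.
Variable R : realType.
Local Notation C := (R[i])%C.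
Variable V : lmodType C.

Definition shiftl (f : nat -> nat -> V) m k := if m is m'.+1 then f m' k else 0.
Definition shiftr (f : nat -> nat -> V) m k := if k is k'.+1 then f m k' else 0.

(* f m k is the coefficient of l^m u^k in F l u. *)
Definition expands_to (Q : nat) (f : nat -> nat -> V) (F : C -> C -> V) :=
  (forall m k, (Q <= m)%N || (Q <= k)%N -> f m k = 0) /\
  (forall l u, F l u = \sum_(m < Q) \sum_(k < Q) (l ^+ m * u ^+ k) *: f m k).

Definition expands (f : nat -> nat -> V) (F : C -> C -> V) := exists Q, expands_to Q f F.

Lemma sum_widen0 (w : nat -> V) Q Q' : (Q <= Q')%N ->
  (forall m, (Q <= m)%N -> w m = 0) -> \sum_(m < Q') w m = \sum_(m < Q) w m.
Proof.
move=> le_QQ' w0; rewrite (big_ord_widen _ w le_QQ') [RHS]big_mkcond.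
by apply: eq_bigr => i _; case: ltnP => // /w0.
Qed.

Lemma expands_widen f F Q Q' : (Q <= Q')%N -> expands_to Q f F -> expands_to Q' f F.
Proof.
move=> le_QQ' [f0 FE]; split=> [m k /orP lt_Q'|l u].
  by apply: f0; case: lt_Q' => /(leq_trans le_QQ') ->; rewrite ?orbT.
rewrite FE (sum_widen0 (w := fun m => \sum_(k < Q') (l ^+ m * u ^+ k) *: f m k) le_QQ').
  apply: eq_bigr => m _.
  rewrite (sum_widen0 (w := fun k => (l ^+ m * u ^+ k) *: f m k) le_QQ') // => k le_Qk.
  by rewrite f0 ?scaler0 ?le_Qk ?orbT.
by move=> m le_Qm; rewrite big1 // => k _; rewrite f0 ?scaler0 ?le_Qm.
Qed.

Lemma expands_ext f g F G : (forall m k, f m k = g m k) -> (forall l u, F l u = G l u) ->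
  expands f F -> expands g G.
Proof.
move=> fg FG [Q [f0 FE]]; exists Q; split=> [m k|l u]; rewrite -?fg; first exact: f0.
by rewrite -FG FE; do 2 (apply: eq_bigr => ? _); rewrite fg.
Qed.

Lemma expandsP c f g F G : expands f F -> expands g G ->
  expands (fun m k => c *: f m k + g m k) (fun l u => c *: F l u + G l u).
Proof.
move=> [Q1 H1] [Q2 H2]; exists (maxn Q1 Q2).
have [f0 FE] := expands_widen (leq_maxl Q1 Q2) H1.
have [g0 GE] := expands_widen (leq_maxr Q1 Q2) H2.
split=> [m k le_Q|l u]; first by rewrite f0 // g0 // scaler0 addr0.
rewrite FE GE scaler_sumr -big_split; apply: eq_bigr => m _.
rewrite scaler_sumr -big_split; apply: eq_bigr => k _ /=.
by rewrite scalerDr !scalerA mulrC.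
Qed.

Lemma expands0 : expands (fun _ _ => 0) (fun _ _ => 0).
Proof. by exists 0%N; split=> // l u; rewrite big_ord0. Qed.

Lemma expandsD f g F G : expands f F -> expands g G ->
  expands (fun m k => f m k + g m k) (fun l u => F l u + G l u).
Proof.
by move=> Hf Hg; apply: expands_ext (expandsP 1 Hf Hg) => *; rewrite scale1r.
Qed.

Lemma expandsZ c f F : expands f F ->
  expands (fun m k => c *: f m k) (fun l u => c *: F l u).
Proof.
by move=> Hf; apply: expands_ext (expandsP c Hf expands0) => *; rewrite addr0.
Qed.

Lemma expandsB f g F G : expands f F -> expands g G ->
  expands (fun m k => f m k - g m k) (fun l u => F l u - G l u).
Proof.
by move=> Hf Hg; apply: expands_ext (expandsP (-1) Hg Hf) => *; rewrite scaleN1r addrC.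
Qed.

Lemma expands_sum (I : Type) (r : seq I) (f : I -> nat -> nat -> V) (F : I -> C -> C -> V) :
  (forall i, expands (f i) (F i)) ->
  expands (fun m k => \sum_(i <- r) f i m k) (fun l u => \sum_(i <- r) F i l u).
Proof.
move=> Hf; elim: r => [|i r IHr].
  by apply: expands_ext expands0 => *; rewrite big_nil.
by apply: expands_ext (expandsD (Hf i) IHr) => *; rewrite big_cons.
Qed.

Lemma expands_cst w : expands (fun m k => if (m == 0)%N && (k == 0)%N then w else 0) (fun _ _ => w).
Proof.
exists 1%N; split=> [[|m] [|k]|l u] //=.
by rewrite !big_ord1 /= mulr1 scale1r.
Qed.

Lemma expands_swap f F : expands f F -> expands (fun m k => f k m) (fun l u => F u l).
Proof.
move=> [Q [f0 FE]]; exists Q; split=> [m k|l u]; first by rewrite orbC; apply: f0.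
rewrite FE exchange_big; apply: eq_bigr => m _; apply: eq_bigr => k _.
by rewrite mulrC.
Qed.

Lemma expands_shiftl f F : expands f F -> expands (shiftl f) (fun l u => l *: F l u).
Proof.
move=> [Q HQ]; have [f1 FE] := expands_widen (leqnSn Q) HQ.
have [f0 FE0] := HQ.
exists Q.+1; split=> [[|m] k //= le_Q|l u]; first by apply: f0; case/orP: le_Q; lia.
rewrite FE0 big_ord_recl /= [X in _ = X + _]big1 ?add0r => [|k _]; last by rewrite scaler0.
rewrite scaler_sumr; apply: eq_bigr => m _ /=.
rewrite big_ord_recr /= f0 ?leqnn ?orbT // scaler0 addr0 scaler_sumr.
by apply: eq_bigr => k _; rewrite scalerA exprS mulrA.
Qed.

Lemma expands_shiftr f F : expands f F -> expands (shiftr f) (fun l u => u *: F l u).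
Proof. by move=> /expands_swap/expands_shiftl/expands_swap. Qed.

(** A polynomial function determines its coefficients: sampling l and u at the powers of 2, which
    are pairwise distinct, [separate] applies once per variable. *)
Lemma expands_uniq f g F : expands f F -> expands g F -> forall m k, f m k = g m k.
Proof.
move=> Hf Hg m k; apply/eqP; rewrite -subr_eq0; apply/eqP; move: m k.
have [Q [h0 hE]] := expandsB Hf Hg.
have inj2 n : {in gtn n &, injective (fun k => 2%:R ^+ k : C)}.
  move=> i j _ _ /eqP; rewrite -!natrX eqr_nat eqn_exp2l // => /eqP //.
have hE' l u : \sum_(m < Q) l ^+ m *: (\sum_(k < Q) u ^+ k *: (f m k - g m k)) = 0.
  rewrite -[RHS](subrr (F l u)) hE; apply: eq_bigr => m _.
  by rewrite scaler_sumr; apply: eq_bigr => k _; rewrite scalerA.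
move=> m k; have [le_Qm|lt_mQ] := leqP Q m; first by rewrite h0 ?le_Qm.
have [le_Qk|lt_kQ] := leqP Q k; first by rewrite h0 ?le_Qk ?orbT.
apply: (separate (w := fun k => f m k - g m k) (inj2 Q) _ lt_kQ) => j /=.
under eq_bigr => i _ do rewrite exprAC.
apply: (separate (w := fun m => \sum_(i < Q) (2%:R ^+ j) ^+ i *: (f m i - g m i)) (inj2 Q) _ lt_mQ) => j' /=.
under eq_bigr => i _ do rewrite exprAC.
exact: hE'.
Qed.

Lemma expands_evl s :
  expands (fun m k => if (k == 0)%N then nth 0 s m else 0) (fun l _ => evl s l).
Proof.
elim: s => [|w s IHs]; first by apply: expands_ext expands0 => // m k; rewrite nth_nil if_same.
apply: expands_ext (expandsD (expands_cst w) (expands_shiftl IHs)) => // -[|m] [|k];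
  by rewrite /= ?addr0 ?add0r.
Qed.

(** A Horner step multiplies by l + u, hence adds the two shifted arrays; Pascal's rule then
    produces the binomials. *)
Lemma expands_evlD s :
  expands (fun m k => 'C(m + k, m)%:R *: nth 0 s (m + k)) (fun l u => evl s (l + u)).
Proof.
elim: s => [|w s IHs].
  by apply: expands_ext expands0 => // m k; rewrite nth_nil scaler0.
apply: expands_ext (expandsD (expands_cst w)
  (expandsD (expands_shiftl IHs) (expands_shiftr IHs))) => [[|m] [|k]|l u] /=.
- by rewrite !addr0 scale1r.
- by rewrite !add0r !bin0.
- by rewrite add0r addr0 ?addn0 ?binn.
- by rewrite add0r !addSn !addnS [in RHS]binS natrD scalerDl addrC.
- by rewrite scalerDl.
Qed.

End Coefficients.

(** * The module axioms in terms of modes *)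

Section Action.
Variable R : realType.
Local Notation C := (R[i])%C.
Variables (V : lmodType C) (d : {linear V -> V}) (act : svgen -> V -> seq V).
Variable A : svgen -> nat -> {linear V -> V}.
Hypothesis AE : forall a k v, nth 0 (act a v) k = A a k v.
Hypothesis act_d : forall a (lam : C) v,
  d (evl (act a v) lam) - evl (act a (d v)) lam = - lam *: evl (act a v) lam.
Hypothesis act_act : forall a b (lam mu : C) v,
  evl (act a (evl (act b v) mu)) lam - evl (act b (evl (act a v) lam)) mu
  = \sum_(c <- [:: gL; gM; gY; gN])
       sv_br a b c lam (- (lam + mu)) *: evl (act c v) (lam + mu).

(** Linearity is known only coefficientwise, and the lists may differ in length, so all three are
    padded to a common length. *)
Lemma evl_act_sum a (c : C) x y l :
  evl (act a (c *: x + y)) l = c *: evl (act a x) l + evl (act a y) l.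
Proof.
have evlE n (s : seq V) : (size s <= n)%N -> evl s l = \sum_(k < n) l ^+ k *: nth 0 s k.
  elim: s n => [|w s IHs] [|n] //= le_sn; first by rewrite big_ord0.
    by rewrite big1 // => k _; rewrite nth_nil scaler0.
  rewrite big_ord_recl /= scale1r (IHs n) // scaler_sumr; congr (_ + _).
  by apply: eq_bigr => k _; rewrite scalerA exprS.
pose n := maxn (size (act a (c *: x + y))) (maxn (size (act a x)) (size (act a y))).
rewrite !(evlE n) ?leq_max ?leqnn ?orbT // scaler_sumr -big_split.
by apply: eq_bigr => k _ /=; rewrite !AE linearP scalerDr !scalerA mulrC.
Qed.

Lemma expands_act_act a b v :
  expands (fun m k => A a m (A b k v)) (fun l u => evl (act a (evl (act b v) u)) l).
Proof.
have evl_act0 l : evl (act a 0) l = 0.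
  have := evl_act_sum a (-1) 0 0 l.
  by rewrite scaler0 addr0 scaleN1r addNr.
suff H s : expands (fun m k => A a m (nth 0 s k)) (fun l u => evl (act a (evl s u)) l).
  by apply: expands_ext (H (act b v)) => // m k; rewrite AE.
elim: s => [|w s IHs].
  by apply: expands_ext (expands0 V) => // m k; rewrite nth_nil linear0.
apply: expands_ext (expandsD (expands_shiftr IHs) (expands_evl (act a w))) => [m [|k]|l u] /=.
- by rewrite add0r AE.
- by rewrite addr0.
- by rewrite -evl_act_sum addrC.
Qed.

(** Every structure polynomial is affine, so on ∂ = -(lam + mu) its values at (lam, mu) = (0, 0),
    (1, 0) and (0, 1) determine it. *)
Lemma sv_brE a b c (l u : C) :
  sv_br a b c l (- (l + u)) = sv_br a b c 0 0
    + (sv_br a b c 1 (-1) - sv_br a b c 0 0) * l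
    + (sv_br a b c 0 (-1) - sv_br a b c 0 0) * u.
Proof. by rewrite /sv_br; case: a; case: b; case: c => /=; ring. Qed.

(* Coefficients of lam^m mu^k in lam (lam + mu)^(m + k - 1) and in mu (lam + mu)^(m + k - 1). *)
Definition binl m k := if m is m'.+1 then 'C(m' + k, m') else 0.
Definition binr m k := if k is k'.+1 then 'C(m + k', m) else 0.

(** Compares the coefficients of lam^m mu^k. Constant structure coefficients give mode m + k, linear
    ones mode m + k - 1; at m = k = 0 the truncated predecessor is harmless because [binl] and
    [binr] vanish there. *)
Lemma coef_comm a b m k v :
  A a m (A b k v) - A b k (A a m v) =
  \sum_(c <- [:: gL; gM; gY; gN])
    ((sv_br a b c 0 0 * 'C(m + k, m)%:R) *: A c (m + k)%N v
     + ((sv_br a b c 1 (-1) - sv_br a b c 0 0) * (binl m k)%:R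
        + (sv_br a b c 0 (-1) - sv_br a b c 0 0) * (binr m k)%:R) *: A c (m + k).-1 v).
Proof.
have HL := expandsB (expands_act_act a b v) (expands_swap (expands_act_act b a v)).
pose E c := expands_evlD (act c v).
have HR := expands_sum [:: gL; gM; gY; gN] (fun c =>
  expandsD (expandsZ (sv_br a b c 0 0) (E c))
  (expandsD (expandsZ (sv_br a b c 1 (-1) - sv_br a b c 0 0) (expands_shiftl (E c)))
  (expandsZ (sv_br a b c 0 (-1) - sv_br a b c 0 0) (expands_shiftr (E c))))).
have := expands_uniq HL (expands_ext (fun _ _ => erefl _) _ HR) m k.
move=> -> => [|l u]; last first.
  rewrite act_act; apply: eq_bigr => c _.
  by rewrite !scalerA addrA -!scalerDl -sv_brE.
apply: eq_bigr => c _; rewrite AE !scalerA; congr (_ + _).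
rewrite scalerDl; congr (_ + _).
  by case: m => [|m]; rewrite /= ?mulr0 ?scaler0 ?scale0r // AE scalerA.
by case: k => [|k]; rewrite /= ?mulr0 ?scaler0 ?scale0r // AE scalerA addnS.
Qed.

Lemma coef_d a k v : d (A a k v) - A a k (d v) = if k is k'.+1 then - A a k' v else 0.
Proof.
have evl_d (s : seq V) l : evl (map d s) l = d (evl s l).
  by elim: s => [|w s IHs] /=; rewrite ?linear0 // linearD linearZ IHs.
have HL := expandsB (expands_evl (map d (act a v))) (expands_evl (act a (d v))).
have HR := expandsZ (-1) (expands_shiftl (expands_evl (act a v))).
(* The identity in lam alone is treated as one in two variables and read off at exponent 0 of the
   second. *)
have := expands_uniq HL (expands_ext (fun _ _ => erefl _) _ HR) k 0.
have nth_d : nth 0 (map d (act a v)) k = d (A a k v).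
  rewrite -AE; have [lt_k|le_k] := ltnP k (size (act a v)).
    by rewrite (nth_map 0).
  by rewrite !nth_default ?size_map // linear0.
rewrite /= nth_d AE => -> => [|l _]; last by rewrite evl_d act_d scaleN1r scaleNr.
by case: k {nth_d} => [|k]; rewrite /= ?scaler0 // AE scaleN1r.
Qed.

End Action.

(** * Eigenvectors in finite-dimensional subspaces *)

Section Spectral.
Variable R : realType.
Local Notation C := (R[i])%C.
Variable V : lmodType C.
Implicit Types (P : V -> Prop) (T H : {linear V -> V}).

Definition subspace P := P 0 /\ (forall (c : C) x y, P x -> P y -> P (c *: x + y)).

(** Linear factors X - a are split off the annihilating polynomial until the remaining cofactor no
    longer kills v; its value at v is then an eigenvector for a. *)
Lemma pev_root_eigen T (q : {poly C}) v : q != 0 -> v != 0 -> pev q T v = 0 ->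
  exists (p : {poly C}) (a : C), pev p T v != 0 /\ T (pev p T v) = a *: pev p T v.
Proof.
have [n] := ubnP (size q); elim: n => // n IHn in q * => lt_qn q0 v0 qv0.
have [sz1|sz1] := eqVneq (size q) 1.
  move/eqP: sz1 => /size_poly1P[c c0 qE]; move: qv0; rewrite qE pevC => /eqP.
  by rewrite scaler_eq0 (negPf c0) (negPf v0).
have /closed_rootP[a /factor_theorem[p qE]] := sz1.
have p0 : p != 0 by apply: contraNneq q0 => p0; rewrite qE p0 mul0r.
have [pv0|pv0] := eqVneq (pev p T v) 0.
  apply: (IHn p) => //; move: lt_qn.
  by rewrite qE size_Mmonic ?monicXsubC // size_XsubC addn2.
exists p, a; split=> //; apply/eqP; rewrite -subr_eq0 -qv0 qE mulrBr pevD pevMX.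
by rewrite -mulrN -polyCN mulrC mul_polyC pevZ scaleNr.
Qed.

Lemma subspaceZ P c x : subspace P -> P x -> P (c *: x).
Proof. by move=> [P0 Plin] Px; rewrite -[_ *: x]addr0; apply: Plin. Qed.

Lemma subspace_sum P n (c : nat -> C) (x : nat -> V) : subspace P ->
  (forall i, P (x i)) -> P (\sum_(i < n) c i *: x i).
Proof.
move=> [P0 Plin] Px; elim: n => [|n IHn]; first by rewrite big_ord0.
by rewrite big_ord_recr /= addrC; apply: Plin.
Qed.

Variable r : nat.
(** For a subspace this says that the dimension is less than [r], without mention of a basis. *)
Definition thin P := forall w : nat -> V, (forall i, P (w i)) ->
  exists c : nat -> C,
    (exists2 i, (i < r)%N & c i != 0) /\ \sum_(i < r) c i *: w i = 0.

Lemma thinW P Q : (forall x, P x -> Q x) -> thin Q -> thin P.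
Proof. by move=> PQ Qthin w Pw; apply: Qthin => i; apply: PQ. Qed.

Lemma iter_stable P (T : V -> V) v i : (forall x, P x -> P (T x)) -> P v -> P (iter i T v).
Proof. by move=> PT Pv; elim: i => //= i; apply: PT. Qed.

(** The first [r] iterates of T on v are dependent, which yields an annihilating polynomial; the
    eigenvector is a polynomial in T applied to v, so it stays in P. *)
Lemma thin_eigen P T v : subspace P -> thin P -> (forall x, P x -> P (T x)) ->
  P v -> v != 0 -> exists w, [/\ P w, w != 0 & exists a, T w = a *: w].
Proof.
move=> sP tP PT Pv v0; have PTi i : P (iter i T v) by apply: iter_stable.
have [c [[i lt_ir ci0] cv0]] := tP _ PTi.
pose q := \poly_(i < r) c i.
have [||p [a [pv0 pvE]]] := @pev_root_eigen T q v _ v0.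
- apply: contraNneq ci0 => q0; have := coef_poly r c i.
  by rewrite -/q q0 coef0 lt_ir => <-.
- rewrite (@pev_widen _ _ _ _ _ r) ?size_poly // -[RHS]cv0.
  by apply: eq_bigr => j _; rewrite coef_poly ltn_ord.
exists (pev p T v); split=> //; last by exists a.
exact: (@subspace_sum P _ (fun i => p`_i) (fun i => iter i T v)).
Qed.

(** T shifts H-eigenvalues by c != 0, so the iterates of T on v have distinct eigenvalues and cannot
    all be nonzero in a thin P. The last nonzero iterate is the required vector. *)
Lemma thin_kill P H T c v : c != 0 -> thin P -> (forall x, P x -> P (T x)) ->
  (forall x, P x -> H (T x) - T (H x) = c *: T x) ->
  P v -> v != 0 -> (exists a, H v = a *: v) ->
  exists w, [/\ P w, w != 0, T w = 0 & exists a, H w = a *: w].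
Proof.
move=> c0 tP PT HT Pv v0 [a Hv].
have PTi i : P (iter i T v) by apply: iter_stable.
have HTi i : H (iter i T v) = (a + c *+ i) *: iter i T v.
  elim: i => [|i IHi]; first by rewrite addr0.
  move/eqP: (HT _ (PTi i)); rewrite subr_eq /= => /eqP ->.
  by rewrite IHi linearZ -scalerDl mulrS addrCA.
have HTij i j : iter j H (iter i T v) = (a + c *+ i) ^+ j *: iter i T v.
  by elim: j => [|j IHj]; rewrite ?scale1r //= IHj linearZ /= HTi scalerA -exprSr.
have exT : exists i, iter i T v == 0.
  have [e [[i lt_ir ei0] ev0]] := tP _ PTi; exists i.
  suff: e i *: iter i T v = 0.
    by move=> /eqP; rewrite scaler_eq0 (negPf ei0).
  (* Applying powers of H to the dependency gives the moments of the distinct eigenvalues a + c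
     i. *)
  apply: (separate (x := fun i => a + c *+ i) (w := fun i => e i *: iter i T v) _ _ lt_ir).
    move=> j k _ _ /addrI /eqP; rewrite -![c *+ _]mulr_natr -subr_eq0 -mulrBr mulf_eq0 (negPf c0).
    by rewrite subr_eq0 eqr_nat => /eqP.
  move=> j; have := congr1 (iter j H) ev0; rewrite iter_lin0 iter_lin_sum => {2}<-.
  by apply: eq_bigr => k _; rewrite iter_linZ HTij !scalerA mulrC.
case: (ex_minnP exT) => -[|i] Ti0 min_i; first by rewrite (Ti0 : v == 0) in v0.
exists (iter i T v); split=> //; last by exists (a + c *+ i).
  by apply/negP => /min_i; rewrite ltnn.
exact/eqP.
Qed.

(* Kills T_(n-1), ..., T_0 in this order: each T_j only has to preserve the
   vectors already killed by the later operators. *)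
Lemma thin_kill_family P H (T : nat -> {linear V -> V}) (c : nat -> C) n v :
  thin P -> (forall j, c j != 0) ->
  (forall x j, P x -> (n <= j)%N -> T j x = 0) ->
  (forall j x, P x -> (forall i, (j < i)%N -> T i x = 0) -> P (T j x)) ->
  (forall i j x, (j < i)%N -> P x -> (forall i, (j < i)%N -> T i x = 0) -> T i (T j x) = 0) ->
  (forall j x, P x -> H (T j x) - T j (H x) = c j *: T j x) ->
  P v -> v != 0 -> (exists a, H v = a *: v) ->
  exists w, [/\ P w, w != 0, forall j, T j w = 0 & exists a, H w = a *: w].
Proof.
move=> tP c0 Tn PT TT HT Pv v0 Hv.
suff Hm m : (m <= n)%N -> exists w, [/\ P w, w != 0,
    forall j, (n - m <= j)%N -> T j w = 0 & exists a, H w = a *: w].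
  have [//|w [Pw w0 Tw Hw]] := Hm n; exists w; split=> // j.
  by apply: Tw; rewrite subnn.
elim: m => [|m IHm] le_mn.
  by exists v; split=> // j; rewrite subn0; apply: Tn.
have [|w [Pw w0 Tw Hw]] := IHm; first exact: ltnW.
set j := (n - m.+1)%N; have jE : (n - m = j.+1)%N by lia.
pose Q x := P x /\ forall i, (j < i)%N -> T i x = 0.
have [||||||w' [[Pw' Tw'] w'0 Tjw' Hw']] := @thin_kill Q H (T j) (c j) w (c0 j) => //.
- by apply: thinW tP => x [].
- move=> x [Px Tx]; split; first exact: PT.
  by move=> i lt_ji; apply: TT.
- by move=> x [Px _]; apply: HT.
- by split=> // i lt_ji; apply: Tw; rewrite jE.
exists w'; split=> // i; rewrite leq_eqVlt => /orP[/eqP <- //|]; exact: Tw'.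
Qed.

End Spectral.

(** * The filtration *)

(* The shift for M, Y and N makes the filtration below stable under all of their modes. *)
Definition wt (a : svgen) (k : nat) := if a is gL then k else k.+1.

Section Filtration.
Variable R : realType.
Local Notation C := (R[i])%C.
Variables (V : lmodType C) (d : {linear V -> V}) (A : svgen -> nat -> {linear V -> V}).
Hypothesis dA : forall a k v,
  d (A a k v) - A a k (d v) = if k is k'.+1 then - A a k' v else 0.

Definition filt n (v : V) := forall a k, (n <= wt a k)%N -> A a k v = 0.

Lemma wtS a k : wt a k.+1 = (wt a k).+1. Proof. by case: a. Qed.

Lemma filt_subspace n : subspace (filt n).
Proof.
split=> [a k _|c x y Fx Fy a k le_n]; first by rewrite linear0.
by rewrite linearP Fx // Fy // scaler0 addr0.
Qed.

Lemma A_d a k v : A a k (d v) = d (A a k v) + (if k is k'.+1 then A a k' v else 0).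
Proof.
move/eqP: (dA a k v); rewrite subr_eq => /eqP ->.
by case: k => [|k]; rewrite ?add0r ?addr0 // addrAC addNr add0r.
Qed.

(** Moving a mode past ∂ lowers its index by at most one, so ∂^i raises the vanishing threshold by
    at most i. *)
Lemma A_iter_d n v i a j : filt n.+1 v -> (n + i < wt a j)%N -> A a j (iter i d v) = 0.
Proof.
move=> Fv; elim: i j => [|i IHi] j lt_j; first by apply: Fv; rewrite addn0 in lt_j.
rewrite /= A_d IHi ?linear0 ?add0r; last by lia.
by case: j lt_j => // j; rewrite wtS => lt_j; rewrite IHi //; lia.
Qed.

(** At the threshold only the term in which every ∂ lowers the index survives, and it has
    coefficient 1. *)
Lemma A_iter_d_top n v i a j : filt n.+1 v -> wt a j = n ->
  A a (j + i) (iter i d v) = A a j v.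
Proof.
move=> Fv wj; elim: i => [|i IHi]; first by rewrite addn0.
have wji : wt a (j + i) = (n + i)%N.
  by elim: i {IHi} => [|i IHi]; rewrite ?addn0 // !addnS wtS IHi.
by rewrite addnS /= A_d IHi (@A_iter_d n) ?linear0 ?add0r // wtS wji; lia.
Qed.

(* Cheng--Kac: in the lowest nonzero piece of the filtration the ∂-powers are independent. *)
Lemma filt_free n (w : nat -> V) k : (forall v, filt n v -> v = 0) ->
  (forall i, filt n.+1 (w i)) -> \sum_(i < k) iter i d (w i) = 0 ->
  forall i, (i < k)%N -> w i = 0.
Proof.
move=> min_n Fw; elim: k => // k IHk; rewrite big_ord_recr /= => w0.
have wk0 : w k = 0.
  apply: min_n => a j; rewrite leq_eqVlt => /orP[/eqP nE|]; last exact: Fw.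
  (* A mode of weight n + k kills the lower ∂-powers and turns ∂^k w_k into the weight-n mode of
     w_k; hence w_k lies in [filt n], which is zero. *)
  have := congr1 (A a (j + k)) w0; rewrite linearD linear_sum linear0 big1 => [|i _].
    by rewrite add0r /= (@A_iter_d_top n).
  apply: (@A_iter_d n) => //; have := ltn_ord i.
  have -> : wt a (j + k) = (wt a j + k)%N.
    by elim: (k) => [|l IHl]; rewrite ?addn0 // !addnS wtS IHl.
  by rewrite -nE; lia.
move=> i; rewrite ltnS leq_eqVlt => /orP[/eqP ->//|]; apply: IHk.
by move: w0; rewrite wk0 iter_lin0 addr0.
Qed.

Lemma filt_pev_inj n v (p : {poly C}) : (forall v, filt n v -> v = 0) ->
  filt n.+1 v -> v != 0 -> pev p d v = 0 -> p = 0.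
Proof.
move=> min_n Fv v0; rewrite /pev => pv0; apply/polyP => i; rewrite coef0.
have [le_pi|lt_ip] := leqP (size p) i; first exact: nth_default.
suff: p`_i *: v = 0 by move=> /eqP; rewrite scaler_eq0 (negPf v0) orbF => /eqP.
apply: (filt_free (w := fun i => p`_i *: v) min_n _ _ lt_ip) => [j|].
  exact: subspaceZ (filt_subspace _) Fv.
by rewrite -[RHS]pv0; apply: eq_bigr => j _; rewrite iter_linZ.
Qed.

(** More vectors than generators satisfy a nontrivial relation over C[∂]; by [filt_free] the
    coefficient of each ∂^j in it is a linear relation over C. *)
Lemma filt_thin n : conf_finite d -> (forall v, filt n v -> v = 0) ->
  exists r, thin r (filt n.+1).
Proof.
move=> [gs gsP] min_n; pose r := size gs; exists r.+1.
have gsE (v : V) : exists u : 'I_r -> {poly C}, v = \sum_i pev (u i) d (nth 0 gs i).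
  have [ps ->] := gsP v; exists (fun i => nth 0 ps i).
  (* [zip] truncates to the shorter list; generators left without a coefficient receive the default
     0. *)
  rewrite (big_nth (0, 0)) big_mkord size_zip.
  rewrite (big_ord_widen r (fun i => pev (nth (0, 0) (zip ps gs) i).1 d (nth (0, 0) (zip ps gs) i).2)) ?geq_minr //.
  rewrite big_mkcond; apply: eq_bigr => i _; rewrite leq_min ltn_ord andbT.
  case: ltnP => [lt_i|le_i]; last by rewrite (nth_default _ le_i) pev0.
  by rewrite nth_zip_cond size_zip leq_min lt_i ltn_ord.
move=> w Fw.
have [u uE] := fin_all_exists (fun i : 'I_r.+1 => gsE (w i)).
(* The coefficient matrix, made square by a zero column, is singular; a left kernel vector is the
   relation over C[∂]. *)
pose B : 'M[{poly C}]_r.+1 :=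
  \matrix_(i, j) if unlift ord_max j is Some j' then u i j' else 0.
have /det0P[p p0 pB] : \det B == 0.
  by rewrite (expand_det_col _ ord_max) big1 // => i _; rewrite mxE unlift_none mul0r.
have {pB} pu j : \sum_i p 0 i * u i j = 0.
  have := congr1 (fun m : 'rV_r.+1 => m 0 (lift ord_max j)) pB; rewrite !mxE => {2}<-.
  by apply: eq_bigr => i _; rewrite !mxE liftK.
have pw : \sum_i pev (p 0 i) d (w i) = 0.
  under eq_bigr => i _ do rewrite uE linear_sum.
  rewrite exchange_big big1 //= => j _.
  under eq_bigr => i _ do rewrite -pevM.
  by rewrite -pev_sum pu pev0.
pose N := (\max_i size (p 0%R i))%N.
pose W j := \sum_i (p 0 i)`_j *: w i.
have WE j : W j = \sum_(i < r.+1) (fun i => (p 0 (inord i))`_j) i *: w i.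
  by apply: eq_bigr => i _; rewrite inord_val.
have W0 j : (j < N)%N -> W j = 0.
  apply: (filt_free (w := W) min_n) => [i|].
    rewrite WE.
    exact: (@subspace_sum _ _ (filt n.+1) _ (fun l => (p 0 (inord l))`_i) w (filt_subspace _) Fw).
  rewrite -[RHS]pw; under eq_bigr => i _ do rewrite /W iter_lin_sum.
  rewrite exchange_big; apply: eq_bigr => i _ /=.
  rewrite (@pev_widen _ _ (p 0 i) _ _ N) ?(leq_bigmax i) //.
  by apply: eq_bigr => k _; rewrite iter_linZ.
(* The leading coefficient of a nonzero entry of p makes the relation in that degree nontrivial. *)
have /rV0Pn[i pi0] := p0.
have lt_sN : ((size (p 0%R i)).-1 < N)%N.
  apply: leq_trans (leq_bigmax i); rewrite prednK // lt0n size_poly_eq0 //.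
exists (fun l => (p 0 (inord l))`_(size (p 0 i)).-1); split; last by rewrite -WE W0.
by exists i; rewrite // inord_val -lead_coefE lead_coef_eq0.
Qed.

End Filtration.

(** * Classification *)

Section Classification.
Variable R : realType.
Local Notation C := (R[i])%C.
Variables (V : lmodType C) (d : {linear V -> V}) (A : svgen -> nat -> {linear V -> V}).
Hypothesis dA : forall a k v,
  d (A a k v) - A a k (d v) = if k is k'.+1 then - A a k' v else 0.
Hypothesis comm : forall a b m k v,
  A a m (A b k v) - A b k (A a m v) =
  \sum_(c <- [:: gL; gM; gY; gN])
    ((sv_br a b c 0 0 * 'C(m + k, m)%:R) *: A c (m + k)%N v
     + ((sv_br a b c 1 (-1) - sv_br a b c 0 0) * (binl m k)%:R
        + (sv_br a b c 0 (-1) - sv_br a b c 0 0) * (binr m k)%:R) *: A c (m + k).-1 v).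
Hypothesis A_fin : forall v, exists n, forall a k, (n <= k)%N -> A a k v = 0.
Hypothesis d_fin : conf_finite d.
Hypothesis nontriv : ~ (forall a k v, A a k v = 0).
Hypothesis irr : forall U : V -> Prop, subspace U ->
  (forall x, U x -> U (d x)) -> (forall a k x, U x -> U (A a k x)) ->
  forall w, w != 0 -> U w -> forall x, U x.

(** * Commutators of the modes *)

Let nz := (mulr0, mul0r, oppr0, subrr, subr0, scale0r, addr0, add0r).

Lemma comm_LL m k v : A gL m (A gL k v) = A gL k (A gL m v)
  + ((binl m k)%:R - (binr m k)%:R) *: A gL (m + k).-1 v.
Proof.
apply/eqP; rewrite addrC -subr_eq; apply/eqP.
rewrite comm !big_cons big_nil /sv_br /= !nz; congr (_ *: _); ring.
Qed.

Lemma comm_LM m k v : A gL m (A gM k v) = A gM k (A gL m v)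
  - (binr m k)%:R *: A gM (m + k).-1 v.
Proof.
apply/eqP; rewrite addrC -subr_eq -scaleNr; apply/eqP.
rewrite comm !big_cons big_nil /sv_br /= !nz; congr (_ *: _); ring.
Qed.

Lemma comm_LN m k v : A gL m (A gN k v) = A gN k (A gL m v)
  - (binr m k)%:R *: A gN (m + k).-1 v.
Proof.
apply/eqP; rewrite addrC -subr_eq -scaleNr; apply/eqP.
rewrite comm !big_cons big_nil /sv_br /= !nz; congr (_ *: _); ring.
Qed.

Lemma comm_LY m k v : A gL m (A gY k v) = A gY k (A gL m v)
  + (2%:R^-1 * (binl m k)%:R - (binr m k)%:R) *: A gY (m + k).-1 v.
Proof.
apply/eqP; rewrite addrC -subr_eq; apply/eqP.
rewrite comm !big_cons big_nil /sv_br /= !nz; congr (_ *: _); by field.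
Qed.

Lemma comm_NM m k v : A gN m (A gM k v) = A gM k (A gN m v)
  + (2%:R * 'C(m + k, m)%:R) *: A gM (m + k) v.
Proof.
apply/eqP; rewrite addrC -subr_eq; apply/eqP.
by rewrite comm !big_cons big_nil /sv_br /= !nz.
Qed.

Lemma comm_NY m k v : A gN m (A gY k v) = A gY k (A gN m v)
  + 'C(m + k, m)%:R *: A gY (m + k) v.
Proof.
apply/eqP; rewrite addrC -subr_eq; apply/eqP.
by rewrite comm !big_cons big_nil /sv_br /= !nz mul1r.
Qed.

Lemma comm_YY m k v : A gY m (A gY k v) = A gY k (A gY m v)
  + ((binl m k)%:R - (binr m k)%:R) *: A gM (m + k).-1 v.
Proof.
apply/eqP; rewrite addrC -subr_eq; apply/eqP.
rewrite comm !big_cons big_nil /sv_br /= !nz; congr (_ *: _); ring.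
Qed.

Lemma comm_MY m k v : A gM m (A gY k v) = A gY k (A gM m v).
Proof. by apply/eqP; rewrite -subr_eq0 comm !big_cons big_nil /sv_br /= !nz. Qed.

Lemma comm_MM m k v : A gM m (A gM k v) = A gM k (A gM m v).
Proof. by apply/eqP; rewrite -subr_eq0 comm !big_cons big_nil /sv_br /= !nz. Qed.

Lemma comm_NN m k v : A gN m (A gN k v) = A gN k (A gN m v).
Proof. by apply/eqP; rewrite -subr_eq0 comm !big_cons big_nil /sv_br /= !nz. Qed.

Lemma comm_ML m k v : A gM k (A gL m v) = A gL m (A gM k v)
  + (binr m k)%:R *: A gM (m + k).-1 v.
Proof. by rewrite comm_LM subrK. Qed.

Lemma comm_NL m k v : A gN k (A gL m v) = A gL m (A gN k v)
  + (binr m k)%:R *: A gN (m + k).-1 v.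
Proof. by rewrite comm_LN subrK. Qed.

Lemma comm_YL m k v : A gY k (A gL m v) = A gL m (A gY k v)
  - (2%:R^-1 * (binl m k)%:R - (binr m k)%:R) *: A gY (m + k).-1 v.
Proof. by rewrite comm_LY addrK. Qed.

Lemma comm_MN m k v : A gM k (A gN m v) = A gN m (A gM k v)
  - (2%:R * 'C(m + k, m)%:R) *: A gM (m + k) v.
Proof. by rewrite comm_NM addrK. Qed.

Lemma comm_YN m k v : A gY k (A gN m v) = A gN m (A gY k v)
  - 'C(m + k, m)%:R *: A gY (m + k) v.
Proof. by rewrite comm_NY addrK. Qed.

Lemma binl1 k : binl 1 k = 1%N. Proof. by rewrite /= bin0. Qed.
Lemma binr1 k : binr 1 k = k. Proof. by case: k => //= k; rewrite add1n bin1. Qed.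

Notation filt := (filt A).

(** * Consequences of irreducibility *)

(** The common kernel of the modes of b is ∂-stable by [A_d] and mode-stable by hypothesis, so it is
    a submodule. *)
Lemma kernel_full b :
  (forall a m k v, (forall j, A b j v = 0) -> A b k (A a m v) = 0) ->
  (exists2 v, v != 0 & forall k, A b k v = 0) -> forall k v, A b k v = 0.
Proof.
move=> Hb [w w0 bw] k v; move: k.
apply: (@irr (fun v => forall k, A b k v = 0) _ _ _ w) => // [|x bx k|a m x bx k].
- split=> [k|c x y bx byy k]; first by rewrite linear0.
  by rewrite linearP bx byy scaler0 addr0.
- by rewrite (A_d dA) bx linear0 add0r; case: k.
- exact: Hb.
Qed.

(** The c-eigenspace of a module endomorphism is a nonzero submodule. *)
Lemma schur (T : {linear V -> V}) c w : (forall x, T (d x) = d (T x)) ->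
  (forall a k x, T (A a k x) = A a k (T x)) -> w != 0 -> T w = c *: w ->
  forall x, T x = c *: x.
Proof.
move=> Td TA w0 Tw; apply: (@irr _ _ _ _ w) => //.
- split=> [|e x y Tx Ty]; first by rewrite linear0 scaler0.
  by rewrite linearP Tx Ty scalerDr !scalerA mulrC.
- by move=> x Tx; rewrite Td Tx linearZ.
- by move=> a k x Tx; rewrite TA Tx linearZ.
Qed.

Lemma exists_filt : exists n, [/\ forall v, filt n v -> v = 0 & exists2 v, v != 0 & filt n.+1 v].
Proof.
pose P n := `[< exists2 v, v != 0 & filt n v >].
have exP : exists n, P n.
  have [v v0] : exists v : V, v != 0.
    apply: contra_notP nontriv => V0 a k v; apply/eqP; apply: contra_notT V0 => nz0.
    by exists (A a k v).
  (* The bound is raised by one because [wt] exceeds the index by one for M, Y and N. *)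
  have [n An] := A_fin v; exists n.+1; apply/asboolP; exists v => // a k le_n.
  by apply: An; case: a le_n => /=; lia.
case: (ex_minnP exP) => -[|n] /asboolP Pn min_n; last first.
  exists n; split=> // v Fv; apply/eqP; apply: contraT => v0.
  by have /min_n : P n by [apply/asboolP; exists v]; rewrite ltnn.
(* Index 0 is impossible: [filt 0] consists of the vectors killed by all modes, and such a nonzero
   submodule would make the action trivial. *)
case: nontriv => a k v; have [w w0 Aw] := Pn; move: a k.
apply: (@irr (fun v => forall a k, A a k v = 0) _ _ _ w) => // [|x Ax a k|a k x Ax b j|a k].
- split=> [a k|c x y Ax Ay a k]; first by rewrite linear0.
  by rewrite linearP Ax Ay scaler0 addr0.
- by rewrite (A_d dA) Ax linear0 add0r; case: k.
- by rewrite Ax linear0.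
- exact: Aw.
Qed.

(** * The lowest nonzero piece of the filtration *)

Section LowestPiece.
Variables (r n : nat).
Hypothesis tF : thin r (filt n.+1).

Lemma filt_M k x : filt n.+1 x -> filt n.+1 (A gM k x).
Proof.
move=> Fx [] m /= le_n.
- by rewrite comm_LM !Fx ?(linear0, scaler0, oppr0, addr0) //=; lia.
- by rewrite comm_MM Fx ?linear0.
- by rewrite -comm_MY Fx ?linear0.
- by rewrite comm_NM !Fx ?(linear0, scaler0, oppr0, addr0) //=; lia.
Qed.

Lemma filt_N k x : filt n.+1 x -> filt n.+1 (A gN k x).
Proof.
move=> Fx [] m /= le_n.
- by rewrite comm_LN !Fx ?(linear0, scaler0, oppr0, addr0) //=; lia.
- by rewrite comm_MN !Fx ?(linear0, scaler0, oppr0, addr0) //=; lia.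
- by rewrite comm_YN !Fx ?(linear0, scaler0, oppr0, addr0) //=; lia.
- by rewrite comm_NN Fx ?linear0.
Qed.

(** Only positive modes are taken: L_0 sends a_m to a multiple of a_(m-1) under the commutator and
    so lowers the weight. *)
Lemma filt_L k x : filt n.+1 x -> filt n.+1 (A gL k.+1 x).
Proof.
move=> Fx [] m /= le_n.
- by rewrite comm_LL !Fx ?(linear0, scaler0, oppr0, addr0) //=; lia.
- by rewrite comm_ML !Fx ?(linear0, scaler0, oppr0, addr0) //=; lia.
- by rewrite comm_YL !Fx ?(linear0, scaler0, oppr0, addr0) //=; lia.
- by rewrite comm_NL !Fx ?(linear0, scaler0, oppr0, addr0) //=; lia.
Qed.

(** The vanishing of M enters because [Y_m, Y_k] is a multiple of M_(m+k-1), whose weight can drop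
    to n. *)
Lemma filt_Y k x : (forall j v, A gM j v = 0) -> filt n.+1 x -> filt n.+1 (A gY k x).
Proof.
move=> M0 Fx [] m /= le_n.
- by rewrite comm_LY !Fx ?(linear0, scaler0, oppr0, addr0) //=; lia.
- exact: M0.
- by rewrite comm_YY M0 Fx ?(linear0, scaler0, oppr0, addr0).
- by rewrite comm_NY !Fx ?(linear0, scaler0, oppr0, addr0) //=; lia.
Qed.

Hypothesis Fnz : exists2 v, v != 0 & filt n.+1 v.

Lemma lowest_eigen (T : {linear V -> V}) : (forall x, filt n.+1 x -> filt n.+1 (T x)) ->
  exists v, [/\ filt n.+1 v, v != 0 & exists a, T v = a *: v].
Proof. by move=> FT; have [v v0 Fv] := Fnz; exact: (thin_eigen (filt_subspace _ _) tF FT Fv v0). Qed.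

(* The zero mode of N has weight 2 on the modes of M and weight 1 on those of Y. *)
Lemma M_zero k v : A gM k v = 0.
Proof.
apply: kernel_full k v => [[] m k v Mv|].
- by rewrite comm_ML !Mv !(linear0, scaler0, oppr0, addr0).
- by rewrite comm_MM Mv linear0.
- by rewrite comm_MY Mv linear0.
- by rewrite comm_MN !Mv !(linear0, scaler0, oppr0, addr0).
have [v [Fv v0 Nv]] := lowest_eigen (filt_N 0).
(* The family is cut off at n, since M_j with j >= n has weight at least n + 1 and kills the
   piece. *)
have [|||||w [_ w0 Mw _]] := @thin_kill_family _ _ _ _ (A gN 0) (A gM) (fun=> 2%:R) n v tF _ _ _ _ _ Fv v0 Nv.
- by move=> _; rewrite pnatr_eq0.
- by move=> x j Fx le_nj; apply: Fx.
- by move=> j x Fx _; apply: filt_M.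
- by move=> i j x lt_ji _ Mx; rewrite comm_MM Mx ?linear0.
- by move=> j x _; rewrite comm_NM addrC addKr bin0 mulr1.
by exists w.
Qed.

(** With M = 0 the modes of Y commute with each other and preserve the piece, so the argument for M
    carries over. *)
Lemma Y_zero k v : A gY k v = 0.
Proof.
apply: kernel_full k v => [[] m k v Yv|].
- by rewrite comm_YL !Yv !(linear0, scaler0, oppr0, addr0).
- by rewrite M_zero linear0.
- by rewrite comm_YY Yv M_zero !(linear0, scaler0, oppr0, addr0).
- by rewrite comm_YN !Yv !(linear0, scaler0, oppr0, addr0).
have [v [Fv v0 Nv]] := lowest_eigen (filt_N 0).
have [|||||w [_ w0 Yw _]] := @thin_kill_family _ _ _ _ (A gN 0) (A gY) (fun=> 1) n v tF _ _ _ _ _ Fv v0 Nv.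
- by move=> _; rewrite oner_eq0.
- by move=> x j Fx le_nj; apply: Fx.
- by move=> j x Fx _; apply: filt_Y M_zero Fx.
- by move=> i j x lt_ji _ Yx; rewrite comm_YY Yx ?linear0 // M_zero scaler0 addr0.
- by move=> j x _; rewrite comm_NY addrC addKr bin0.
by exists w.
Qed.

(** Once M = Y = 0, the operator N_0 commutes with ∂ and all modes, so an eigenvector in the lowest
    piece makes it a scalar by [schur]. *)
Lemma N_zero_mode : exists beta, forall x, A gN 0 x = beta *: x.
Proof.
have [w [_ w0 [beta Nw]]] := lowest_eigen (filt_N 0).
exists beta; apply: (schur _ _ w0) => // [x|[] k x].
- by rewrite (A_d dA) addr0.
- by rewrite comm_NL addn0 /= scale0r addr0.
- by rewrite !M_zero linear0.
- by rewrite !Y_zero linear0.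
- by rewrite comm_NN.
Qed.

(** L_0 and ∂ both have commutator -a_(k-1) with a_k, so their difference is a module endomorphism
    and [schur] applies. *)
Lemma L_zero_mode : exists alpha, forall x, A gL 0 x = d x + alpha *: x.
Proof.
pose T : {linear V -> V} := A gL 0 \- d.
have TE x : T x = A gL 0 x - d x by [].
have Td x : T (d x) = d (T x) by rewrite !TE linearB (A_d dA) addr0.
have dE a k x : d (A a k x) = A a k (d x) - (if k is k'.+1 then A a k' x else 0).
  by rewrite (A_d dA) addrK.
have L0E a k x : A gL 0 (A a k x) = A a k (A gL 0 x) - (if k is k'.+1 then A a k' x else 0).
  case: a.
  - by rewrite comm_LL; case: k => [|k]; rewrite /= sub0r ?oppr0 ?scale0r ?bin0 ?scaleN1r.
  - by case: k => [|k]; rewrite !M_zero !(linear0, addr0).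
  - by case: k => [|k]; rewrite !Y_zero !(linear0, addr0).
  - by rewrite comm_LN; case: k => [|k]; rewrite /= ?scale0r ?bin0 ?scale1r.
have TA a k x : T (A a k x) = A a k (T x).
  by rewrite !TE linearB dE L0E opprB addrA subrK.
have FT x : filt n.+1 x -> filt n.+1 (T x).
  by move=> Fx a k le_n; rewrite -TA Fx ?linear0.
have [w [_ w0 [alpha Tw]]] := lowest_eigen FT.
exists alpha => x; have := schur Td TA w0 Tw x.
by rewrite TE => /eqP; rewrite subr_eq addrC => /eqP.
Qed.

(* The first mode of L gives weights -k and 1 - k to the k-th modes of N and L. *)
Lemma lowest_vector : exists v Delta, [/\ filt n.+1 v, v != 0, A gL 1 v = Delta *: v,
  forall k, A gN k.+1 v = 0 & forall k, A gL k.+2 v = 0].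
Proof.
have [v [Fv v0 Lv]] := lowest_eigen (filt_L 0).
have [|||||w [Fw w0 Nw Lw]] := @thin_kill_family _ _ _ _ (A gL 1) (fun k => A gN k.+1)
  (fun k => - k.+1%:R) n v tF _ _ _ _ _ Fv v0 Lv.
- by move=> j; rewrite oppr_eq0 pnatr_eq0.
- by move=> x j Fx le_nj; apply: Fx => /=; lia.
- by move=> j x Fx _; apply: filt_N.
- by move=> i j x lt_ji _ Nx; rewrite comm_NN Nx ?linear0.
- by move=> j x _; rewrite comm_LN binr1 addrC addKr scaleNr.
(* The second pass stays among the vectors killed by the positive modes of N; L_(j+2) preserves them
   because its commutator with N_(k+1) is a multiple of N_(k+j+2). *)
pose P x := filt n.+1 x /\ forall k, A gN k.+1 x = 0.
have tP : thin r P by apply: thinW tF => x [].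
have [|||||u [[Fu Nu] u0 Lu [Delta LuE]]] := @thin_kill_family _ _ _ P (A gL 1) (fun k => A gL k.+2)
  (fun k => - k.+1%:R) n w tP _ _ _ _ _ (conj Fw Nw) w0 Lw.
- by move=> j; rewrite oppr_eq0 pnatr_eq0.
- by move=> x j [Fx _] le_nj; apply: Fx => /=; lia.
- move=> j x [Fx Nx] _; split=> [|k]; first exact: filt_L.
  by rewrite comm_NL Nx !addSn /= -addSn Nx !(linear0, scaler0, addr0).
- move=> i j x lt_ji _ Lx.
  (* The bracket lands on L_(i+j+3), which is beyond L_(j+2) and hence already kills x. *)
  have -> : A gL i.+2 (A gL j.+2 x) = A gL j.+2 (A gL i.+2 x) +
      ((binl i.+2 j.+2)%:R - (binr i.+2 j.+2)%:R) *: A gL (i + j).+1.+2 x.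
    by rewrite comm_LL; congr (_ + _ *: A gL _ x); lia.
  by rewrite !Lx ?(linear0, scaler0, addr0) //; lia.
- move=> j x _; rewrite comm_LL binr1 binl1 addrC addKr; congr (_ *: _).
  by rewrite -[j.+2]addn1 natrD opprD addrCA subrr addr0.
by exists u, Delta.
Qed.

End LowestPiece.

(** * The rank-one module generated by the lowest vector *)

Section RankOne.
Variables (v : V) (alpha beta Delta : C).
Hypothesis v0 : v != 0.
Hypothesis pev_inj : forall p : {poly C}, pev p d v = 0 -> p = 0.
Hypothesis M0 : forall k x, A gM k x = 0.
Hypothesis Y0 : forall k x, A gY k x = 0.
Hypothesis L0 : A gL 0 v = d v + alpha *: v.
Hypothesis L1 : A gL 1 v = Delta *: v.
Hypothesis L2 : forall k, A gL k.+2 v = 0.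
Hypothesis N0 : A gN 0 v = beta *: v.
Hypothesis N1 : forall k, A gN k.+1 v = 0.

Let rk1_coef := fun a k p => nth 0 (Vrk1_act alpha beta Delta a p) k.

(** Past the end of the list the default 0 agrees with the formula, as divided derivatives of order
    at least [size p] vanish. *)
Lemma rk1_coefN k p : rk1_coef gN k p = beta *: p^`N(k).
Proof.
rewrite /rk1_coef /=; have [lt_k|le_k] := ltnP k (size p).
  by rewrite (nth_map 0) ?size_iota // nth_iota.
rewrite nth_default ?size_map ?size_iota // nderivn_poly0 ?scaler0 //.
Qed.

Lemma rk1_coefL k p : rk1_coef gL k p =
  p^`N(k) * ('X + alpha%:P) + (if k is k'.+1 then Delta *: p^`N(k') else 0).
Proof.
rewrite /rk1_coef /Vrk1_act; have [lt_k|le_k] := ltnP k (size p).+1.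
  by rewrite (nth_map 0) ?size_iota // nth_iota.
rewrite nth_default ?size_map ?size_iota // nderivn_poly0 ?mul0r ?add0r; last by lia.
by case: k le_k => // k le_k; rewrite nderivn_poly0 ?scaler0.
Qed.

(** The model's counterpart of [A_d], giving a recursion on p from the values on the generator 1. *)
Lemma rk1_coefMXaddC a k p c : rk1_coef a k (p * 'X + c%:P) =
  rk1_coef a k p * 'X + (if k is k'.+1 then rk1_coef a k' p else 0) + c *: rk1_coef a k 1.
Proof.
have nil0 a' : (a' = gM \/ a' = gY) -> forall j q, rk1_coef a' j q = 0.
  by move=> [] -> j q; rewrite /rk1_coef nth_nil.
have one0 j : (1 : {poly C})^`N(j.+1) = 0 by rewrite -polyC1 nderivnC.
case: a; first 1 last.
- by rewrite !nil0; [case: k => [|k]; rewrite ?nil0 ?mul0r ?scaler0 ?addr0; auto|auto..].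
- by rewrite !nil0; [case: k => [|k]; rewrite ?nil0 ?mul0r ?scaler0 ?addr0; auto|auto..].
- case: k => [|k]; rewrite !rk1_coefN.
    by rewrite !nderivn0 addr0 scalerDr -scalerAl -!mul_polyC; ring.
  by rewrite nderivnMXaddC one0 !scaler0 addr0 scalerDr scalerAl addrC.
- case: k => [|[|k]]; rewrite !rk1_coefL !(nderivn0, nderivnMXaddC, one0) -!mul_polyC; ring.
Qed.

(** Both sides obey the same recursion in p and agree on v, so the action on C[∂]v is that of the
    model. *)
Lemma A_pev a k p : A a k (pev p d v) = pev (rk1_coef a k p) d v.
Proof.
have A1 j : A a j v = pev (rk1_coef a j 1) d v.
  have one0 i : (1 : {poly C})^`N(i.+1) = 0 by rewrite -polyC1 nderivnC.
  case: a.
  - rewrite rk1_coefL; case: j => [|[|j]]; rewrite ?nderivn0 ?one0 ?mul1r ?mul0r ?add0r ?addr0.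
    + by rewrite L0 pevD pevC -['X]mul1r pevMX pevC scale1r.
    + by rewrite L1 pevZ pevC scale1r.
    + by rewrite L2 scaler0 pev0.
  - by rewrite M0 /rk1_coef nth_nil pev0.
  - by rewrite Y0 /rk1_coef nth_nil pev0.
  - rewrite rk1_coefN; case: j => [|j]; rewrite ?nderivn0 ?one0.
    + by rewrite N0 pevZ pevC scale1r.
    + by rewrite N1 scaler0 pev0.
elim/poly_ind: p k => [|p c IHp] k.
  suff -> : rk1_coef a k 0 = 0 by rewrite !pev0 linear0.
  case: a {A1}; rewrite ?rk1_coefL ?rk1_coefN ?/rk1_coef ?nth_nil //.
    by rewrite linear0 mul0r add0r; case: k => // k; rewrite linear0 scaler0.
  by rewrite linear0 scaler0.
rewrite pevD pevMX pevC linearD linearZ /= (A_d dA) A1 IHp rk1_coefMXaddC !pevD pevMX pevZ.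
by congr (_ + _ + _); case: k => [|k]; rewrite ?pev0.
Qed.

Lemma rank_one_span x : exists p : {poly C}, x = pev p d v.
Proof.
apply: (@irr (fun x => exists p : {poly C}, x = pev p d v) _ _ _ v) => //.
- split=> [|c _ _ [p ->] [q ->]]; first by exists 0; rewrite pev0.
  by exists (c *: p + q); rewrite pev_lin.
- by move=> _ [p ->]; exists (p * 'X); rewrite pevMX.
- by move=> a k _ [p ->]; exists (rk1_coef a k p); rewrite A_pev.
- by exists 1; rewrite pevC scale1r.
Qed.

(* For Delta = beta = 0 the span of (∂ + alpha) v would be a proper submodule. *)
Lemma rank_one_param : (Delta, beta) != (0, 0).
Proof.
apply/eqP => -[D0 b0].
pose q : {poly C} := 'X + alpha%:P.
have q0 : q != 0 by rewrite -size_poly_eq0 size_XaddC.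
have qv0 : pev q d v != 0 by apply: contraNneq q0 => /pev_inj ->.
have [||||p pE] := @irr (fun x => exists p : {poly C}, x = pev (p * q) d v) _ _ _ (pev q d v) qv0 _ v.
- split=> [|c _ _ [p ->] [p' ->]]; first by exists 0; rewrite mul0r pev0.
  by exists (c *: p + p'); rewrite mulrDl -scalerAl pev_lin.
- by move=> _ [p ->]; exists (p * 'X); rewrite mulrAC pevMX.
- move=> [] k _ [p ->].
  (* For Delta = 0 every L_k maps C[∂]v into multiples of q. *)
  + exists ((p * q)^`N(k)); rewrite A_pev rk1_coefL -/q D0.
    by case: k => [|k]; rewrite ?scale0r addr0.
  + by exists 0; rewrite M0 mul0r pev0.
  + by exists 0; rewrite Y0 mul0r pev0.
  + by exists 0; rewrite A_pev rk1_coefN b0 scale0r mul0r.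
- by exists 1; rewrite mul1r.
(* If v lay in the submodule, then p q = 1, contradicted at the root -alpha of q. *)
have /pev_inj /(congr1 (fun f : {poly C} => f.[- alpha])) : pev (p * q - 1) d v = 0.
  by rewrite pevD -polyC1 -polyCN pevC scaleN1r -pE subrr.
by rewrite !hornerE addNr mulr0 => /eqP; rewrite sub0r oppr_eq0 oner_eq0.
Qed.

(** The map is the inverse of p |-> p(∂)v, which is onto by irreducibility and injective by
    freeness. *)
Lemma rank_one_iso : exists phi : V -> {poly C},
  [/\ forall c x y, phi (c *: x + y) = c *: phi x + phi y, bijective phi,
    forall x, phi (d x) = Vrk1_d (phi x)
  & forall a x k, phi (A a k x) = nth 0 (Vrk1_act alpha beta Delta a (phi x)) k].
Proof.
have [phi phiK] := choice rank_one_span.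
have pevK p : phi (pev p d v) = p.
  apply/eqP; rewrite -subr_eq0; apply/eqP/pev_inj.
  by rewrite pevD -scaleN1r pevZ -phiK scaleN1r subrr.
exists phi; split=> [c x y||x|a x k].
- by rewrite [in LHS](phiK x) [in LHS](phiK y) -pev_lin pevK.
- by exists (fun p => pev p d v) => x //; rewrite -phiK.
- by rewrite [in LHS](phiK x) -pevMX pevK /Vrk1_d mulrC.
- by rewrite [in LHS](phiK x) A_pev pevK.
Qed.

End RankOne.

Lemma irreducible_rank_one : exists alpha beta Delta : C, (Delta, beta) != (0, 0) /\
  exists phi : V -> {poly C},
  [/\ forall c x y, phi (c *: x + y) = c *: phi x + phi y, bijective phi,
    forall x, phi (d x) = Vrk1_d (phi x)
  & forall a x k, phi (A a k x) = nth 0 (Vrk1_act alpha beta Delta a (phi x)) k].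
Proof.
have [n [min_n Fnz]] := exists_filt.
have [r tF] := filt_thin dA d_fin min_n.
have M0 := M_zero tF Fnz; have Y0 := Y_zero tF Fnz.
have [beta N0] := N_zero_mode tF Fnz.
have [alpha L0] := L_zero_mode tF Fnz.
have [v [Delta [Fv v0 L1 N1 L2]]] := lowest_vector tF Fnz.
have inj p := @filt_pev_inj _ _ _ _ dA n v p min_n Fv v0.
exists alpha, beta, Delta; split.
  exact: (rank_one_param v0 inj M0 Y0 (L0 v) L1 L2 (N0 v) N1).
exact: (rank_one_iso v0 inj M0 Y0 (L0 v) L1 L2 (N0 v) N1).
Qed.

End Classification.

(** * Passage from the lambda-action to its modes *)

Theorem theorem4p5 (R : realType) (V : lmodType (R[i])%C)
    (d : V -> V) (act : svgen -> V -> seq V) :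
  is_conf_module d act ->
  conf_finite d ->
  ~ conf_trivial act ->
  conf_irreducible d act ->
  exists alpha beta Delta : (R[i])%C,
    (Delta, beta) != (0, 0) /\
    conf_iso d act (@Vrk1_d R) (Vrk1_act alpha beta Delta).
Proof.
move=> [d_lin act_lin act_d act_act] d_fin act_nontriv act_irr.
pose D : {linear V -> V} := HB.pack d (GRing.isLinear.Build _ _ _ _ d d_lin).
pose A a k : {linear V -> V} := HB.pack (fun x => nth 0 (act a x) k)
  (GRing.isLinear.Build _ _ _ _ (fun x => nth 0 (act a x) k) (act_lin a k)).
have AE a k x : nth 0 (act a x) k = A a k x by [].
have dA := @coef_d _ _ D act A AE act_d.
have comm := coef_comm AE act_act.
apply: (@irreducible_rank_one R V D A dA comm _ d_fin) => [x|A0|U [U0 Ulin] Ud UA w w0 Uw].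
(* The longest of the four coefficient lists bounds the nonzero modes on x. *)
- exists (\max_(a <- [:: gL; gM; gY; gN]) size (act a x))%N => a k le_k.
  rewrite -AE nth_default //; apply: leq_trans le_k.
  by rewrite !big_cons big_nil; case: a; rewrite !leq_max leqnn ?orbT.
- by apply: act_nontriv => a v k; apply: A0.
- have [|Unull|//] := act_irr U; first by split=> // a x k; apply: UA.
  by rewrite (Unull w Uw) eqxx in w0.
Qed.
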